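(* Let $q\in\{1,2\}$, $\alpha\in(0,1)$, and let $n,N\ge1$ be integers. Assume that either $|\mathcal X|=\infty$ or $|\mathcal Y|=\infty$, and that the comparison function is given by $\psi(y',y'',y)=\ell(y',y)-\ell(y'',y)$, where the loss $\ell:\widehat{\mathcal Y}\times\mathcal Y\to\mathbb R_+$ takes values in $[0,B]$. Let $\widehat T$ be a black-box test for algorithm comparison, and assume that $\widehat T$ satisfies the stability-constrained validity condition $$\mathbb P_P\big(\widehat T(\mathcal A_0,\mathcal A_1,\mathcal D_N)=1\big)\le\alpha\quad\text{for all }\mathcal A_0,\mathcal A_1,P\text{ such that }\beta_q(\mathcal A_l,P,n)\le\gamma_q\text{ for each }l=0,1\text{ and }\Delta_{P,n}(\mathcal A_0,\mathcal A_1)\le0,$$ for some stability parameter $\gamma_q\ge2B/n^{1/q}$. Then for any algorithms $\mathcal A_0,\mathcal A_1$ and any distribution $P$ on $\mathcal X\times\mathcal Y$ with $\beta_q(\mathcal A_l,P,n)\le\gamma_q$ for $l=0,1$ and $\Delta_{P,n}(\mathcal A_0,\mathcal A_1)>0$, $$\mathbb P_P\big(\widehat T(\mathcal A_0,\mathcal A_1,\mathcal D_N)=1\big)\le\left[\alpha\left(1+\frac{\Delta_{P,n}(\mathcal A_0,\mathcal A_1)+\frac{B(\alpha^{-1}-1)}{N}}{\Delta_P^{\max}-\frac{B(\alpha^{-1}-1)}{N}}\right)^{N/n}\right]\wedge1,$$ provided that $\Delta_P^{\max}>\frac{B(\alpha^{-1}-1)}{N}$.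
   Context: $\mathcal X,\mathcal Y,\widehat{\mathcal Y}$ are measurable spaces; all functions are assumed measurable as appropriate, and singletons $\{(x,y)\}\subset\mathcal X\times\mathcal Y$ are measurable. $a\wedge b=\min(a,b)$; $[n]=\{1,\dots,n\}$. Algorithm: a map $\mathcal A:\bigcup_{m\ge0}(\mathcal X\times\mathcal Y)^m\times[0,1]\to\{\text{measurable functions }\mathcal X\to\widehat{\mathcal Y}\}$, taking a data set (a finite tuple of any size) and a random seed $\xi\in[0,1]$ and returning a fitted model $\mathcal A(\mathcal D;\xi)$; for each $m$ the map $((x_1,y_1),\dots,(x_m,y_m),\xi,x)\mapsto[\mathcal A(\{(x_i,y_i)\}_{i\in[m]};\xi)](x)$ is measurable. No symmetry in the data points is assumed. Comparison risk: for measurable $f_0,f_1:\mathcal X\to\widehat{\mathcal Y}$, $\Delta_P(f_0,f_1)=\mathbb E_P[\psi(f_0(X),f_1(X),Y)]$ with $(X,Y)\sim P$, and $\Delta_P^{\max}=\sup_{f_0,f_1}\Delta_P(f_0,f_1)$. For algorithms, $\Delta_{P,n}(\mathcal A_0,\mathcal A_1)=\mathbb E_P[\Delta_P(\hat f_{0,n},\hat f_{1,n})]$ where $\hat f_{l,n}=\mathcal A_l(\{(X_i,Y_i)\}_{i\in[n]};\xi)$ for $l=0,1$ (same seed for both), $(X_i,Y_i)$ i.i.d. from $P$ and $\xi\sim\mathrm{Unif}[0,1]$ independent. $\ell_q$-stability of a single algorithm: for $(X_1,Y_1),\dots,(X_{n+1},Y_{n+1})$ i.i.d. from $P$, independent $\xi\sim\mathrm{Unif}[0,1]$,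 $\hat f_n=\mathcal A(\{(X_i,Y_i)\}_{i\in[n]};\xi)$ and $\hat f_n^{-j}=\mathcal A(\{(X_i,Y_i)\}_{i\in[n]\setminus\{j\}};\xi)$, $$\beta_q(\mathcal A,P,n)=\max_{j=1,\dots,n}\mathbb E\left[\left|\ell(\hat f_n(X_{n+1}),Y_{n+1})-\ell(\hat f_n^{-j}(X_{n+1}),Y_{n+1})\right|^q\right]^{1/q}.$$ Data: $\mathcal D_N=\{(X_i,Y_i)\}_{i\in[N]}$ with $(X_i,Y_i)$ i.i.d. from $P$. $\mathbb P_P$ is over $\mathcal D_N$ and any randomization in $\widehat T$. Black-box test (algorithm comparison): let $\mathfrak D=\bigcup_{m\ge0}(\mathcal X\times\mathcal Y)^m$. A function $\widehat T$ taking two algorithms $\mathcal A_0,\mathcal A_1$ and a data set $\mathcal D\in\mathfrak D$ and returning a (possibly randomized) output $\widehat T(\mathcal A_0,\mathcal A_1,\mathcal D)\in\{0,1\}$ is a black-box test if, for some functions $g^{(1)},g^{(2)},\dots,g$ (not depending on the algorithms) and random seeds $\zeta^{(1)},\zeta^{(2)},\dots,\zeta$ i.i.d. $\mathrm{Unif}[0,1]$ (independent of the data), it is produced as follows. (1) At stage $r=1$, generate a data set in $\mathfrak D$ and a seed in $[0,1]$, $(\mathcal D^{(1)},\xi^{(1)})=g^{(1)}(\mathcal D,\zeta^{(1)})$, and compute $\hat f_l^{(1)}=\mathcal A_l(\mathcal D^{(1)};\xi^{(1)})$ for $l=0,1$. (2) For each stage $r=2,3,\dots$, generate $(\mathcal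 D^{(r)},\xi^{(r)})=g^{(r)}\big(\mathcal D,(\mathcal D^{(s)})_{1\le s<r},(\hat f_l^{(s)})_{1\le s<r;\,l=0,1},(\zeta^{(s)})_{1\le s\le r},(\xi^{(s)})_{1\le s<r}\big)$ and compute $\hat f_l^{(r)}=\mathcal A_l(\mathcal D^{(r)};\xi^{(r)})$ for $l=0,1$. (3) Repeat until some stopping criterion (evaluated on the information generated so far) is reached; $\hat r$ denotes the data-dependent total number of rounds, which is finite. (4) Return $\widehat T(\mathcal A_0,\mathcal A_1,\mathcal D)=g\big(\mathcal D,(\mathcal D^{(r)})_{1\le r\le\hat r},(\hat f_l^{(r)})_{1\le r\le\hat r;\,l=0,1},(\zeta^{(r)})_{1\le r\le\hat r},(\xi^{(r)})_{1\le r\le\hat r},\zeta\big)$, as a measurable function of $(\mathcal D,\zeta^{(1)},\zeta^{(2)},\dots,\zeta)$. *)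

(* Defs.v *)
From HB Require Import structures.
From mathcomp Require Import all_boot all_order all_algebra.
From mathcomp Require Import all_classical all_reals all_analysis.
From mathcomp Require Import measurable_realfun.
Set Implicit Arguments.
Unset Strict Implicit.
Unset Printing Implicit Defensive.
Import Order.TTheory GRing.Theory Num.Theory.
Import numFieldNormedType.Exports.
Local Open Scope classical_set_scope.
Local Open Scope ring_scope.

HB.instance Definition _ (R : realType) := isPointed.Build {i01 R} 0%:i01.

(* [0,1] with the trace of the Borel sets of R *)
Definition seed (R : realType) : Type :=
  g_sigma_algebra_preimageType (fun x : {i01 R} => x%:num : R).

Section clamp.
Context {R : realType}.

Lemma clamp_ge0 (x : R) : 0 <= Num.min 1 (Num.max 0 x).
Proof. by rewrite le_min ler01 le_max lexx. Qed.

Lemma clamp_le1 (x : R) : Num.min 1 (Num.max 0 x) <= 1.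
Proof. by rewrite ge_min lexx. Qed.

Definition clamp (x : measurableTypeR R) : seed R :=
  Itv01 (clamp_ge0 x) (clamp_le1 x).

Lemma measurable_clamp : measurable_fun [set: measurableTypeR R] clamp.
Proof.
move=> _ _ [B mB <-]; rewrite !setTI.
rewrite -[X in measurable X]setTI.
have mc : measurable_fun [set: R] (fun x : R => Num.min 1 (Num.max 0 x)).
  by apply: measurable_minr => //; exact: measurable_maxr.
exact: mc.
Qed.

HB.instance Definition _ :=
  isMeasurableFun.Build _ _ _ _ clamp measurable_clamp.

End clamp.

(* the clamping is the identity on [0,1], where uniform_prob is carried *)
Definition unif01 (R : realType) : probability (seed R) R :=
  distribution (uniform_prob (@ltr01 R)) clamp.

Section iid.
Context {d} {T : measurableType d} {R : realType}.

Definition tcons m (p : T * m.-tuple T) : m.+1.-tuple T :=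
  [the m.+1.-tuple T of p.1 :: p.2].

Lemma measurable_tcons m : measurable_fun [set: T * m.-tuple T] (@tcons m).
Proof. exact: measurable_cons. Qed.

HB.instance Definition _ m :=
  isMeasurableFun.Build _ _ _ _ (@tcons m) (@measurable_tcons m).

Fixpoint iid (P : probability T R) (m : nat) : probability (m.-tuple T) R :=
  match m with
  | 0 => \d_([tuple] : 0.-tuple T)
  | k.+1 => distribution (P \x iid P k)%E (@tcons k)
  end.

End iid.

(* sequences of seeds, with the product sigma-algebra *)
Definition seed_cylinder (R : realType) : set (set (nat -> seed R)) :=
  [set C | exists i, exists2 B : set (seed R),
     measurable B & C = [set z | B (z i)]].

Definition seeds (R : realType) : Type := g_sigma_algebraType (@seed_cylinder R).

(* under Q the coordinates are independent, each with law Unif[0,1] *)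
Definition iid_seeds (R : realType) (Q : probability (seeds R) R) : Prop :=
  forall (k : nat) (B : nat -> set (seed R)), (forall i, measurable (B i)) ->
    Q [set z : seeds R | forall i, (i < k)%N -> B i (z i)] =
    (\prod_(i < k) unif01 R (B i))%E.

Section learning.
Context {dX dY dH : measure_display} {X : measurableType dX}
  {Y : measurableType dY} {Yh : measurableType dH} {R : realType}.

Record algorithm := Algorithm {
  fit :> seq (X * Y) -> seed R -> {mfun X >-> Yh};
  measurable_fit : forall m : nat,
    measurable_fun [set: (m.-tuple (X * Y) * seed R) * X]
      (fun w : (m.-tuple (X * Y) * seed R) * X => fit w.1.1 w.1.2 w.2) }.

Section comparison.
Variables (psi : Yh -> Yh -> Y -> R) (P : probability (X * Y)%type R).

Definition comparison_risk (f0 f1 : {mfun X >-> Yh}) : \bar R :=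
  ('E_P[fun z => psi (f0 z.1) (f1 z.1) z.2])%E.

Definition max_comparison_risk : \bar R :=
  ereal_sup (range (fun f : {mfun X >-> Yh} * {mfun X >-> Yh} =>
    comparison_risk f.1 f.2)).

Definition algorithm_comparison_risk (n : nat) (A0 A1 : algorithm) : \bar R :=
  (\int[iid P n \x unif01 R]_w
    comparison_risk (A0 w.1 w.2) (A1 w.1 w.2))%E.

End comparison.

Definition leave_out n (D : n.-tuple (X * Y)) (j : 'I_n) : seq (X * Y) :=
  [seq tnth D i | i <- enum 'I_n & i != j].

(* w.1.1 lists the n training points, w.1.2 is the seed and w.2 the test point.
   The base value 0 of the maximum is harmless, norms being nonnegative. *)
Definition stability (loss : Yh -> Y -> R) (q : nat) (A : algorithm)
    (P : probability (X * Y)%type R) (n : nat) : \bar R :=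
  \big[maxe/0%E]_(j < n)
    ('N[(iid P n \x unif01 R) \x P]_(q%:R%:E)
      [(fun w => (loss (A w.1.1 w.1.2 w.2.1) w.2.2
                  - loss (A (leave_out w.1.1 j) w.1.2 w.2.1) w.2.2)%:E)])%E.

(* One stage r: D^(r), the two models fitted on D^(r), zeta^(r) and xi^(r). *)
Record stage := Stage {
  stage_data : seq (X * Y);
  stage_model0 : {mfun X >-> Yh};
  stage_model1 : {mfun X >-> Yh};
  stage_zeta : seed R;
  stage_xi : seed R }.

(* The first r stages. Stages are numbered from 1 and zeta^(r) = z r. *)
Fixpoint run (g : nat -> seq (X * Y) -> seq stage -> seed R ->
                  seq (X * Y) * seed R)
    (A0 A1 : algorithm) (D : seq (X * Y)) (z : seeds R) (r : nat) : seq stage :=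
  match r with
  | 0 => [::]
  | s.+1 => let h := run g A0 A1 D z s in
            let: (Dr, xi) := g s.+1 D h (z s.+1) in
            rcons h (Stage Dr (A0 Dr xi) (A1 Dr xi) (z s.+1) xi)
  end.

(* The seeds of T are the terms of z: z 0 is the seed zeta of the final decision
   and z r, r >= 1, that of stage r. The functions g, stop and out see the
   algorithms only through the recorded stages. They need not be measurable:
   measurability is asked of T only. *)
Definition black_box_test
    (T : algorithm -> algorithm -> seq (X * Y) -> seeds R -> bool) : Prop :=
  (exists (g : nat -> seq (X * Y) -> seq stage -> seed R ->
               seq (X * Y) * seed R)
          (stop : seq (X * Y) -> seq stage -> bool)
          (out : seq (X * Y) -> seq stage -> seed R -> bool),
     forall A0 A1 D z, exists r : nat,
       [/\ (0 < r)%N, stop D (run g A0 A1 D z r),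
           forall s, (0 < s < r)%N -> ~~ stop D (run g A0 A1 D z s)
         & T A0 A1 D z = out D (run g A0 A1 D z r) (z 0)]) /\
  (forall A0 A1 (m : nat),
     measurable_fun [set: m.-tuple (X * Y) * seeds R]
       (fun w : m.-tuple (X * Y) * seeds R => T A0 A1 w.1 w.2)).

Definition rejection_prob
    (T : algorithm -> algorithm -> seq (X * Y) -> seeds R -> bool)
    (Q : probability (seeds R) R) (A0 A1 : algorithm)
    (P : probability (X * Y)%type R) (N : nat) : \bar R :=
  (iid P N \x Q)%E [set w : N.-tuple (X * Y) * seeds R |
                           T A0 A1 w.1 w.2].

End learning.

Arguments algorithm {dX dY dH} X Y Yh R.

(* Main.v *)
Require Import Defs.
From HB Require Import structures.
From mathcomp Require Import all_boot all_order all_algebra.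
From mathcomp Require Import all_classical all_reals all_analysis.
From mathcomp Require Import measurable_realfun.
From mathcomp Require Import ring lra.
Set Implicit Arguments.
Unset Strict Implicit.
Unset Printing Implicit Defensive.
Import Order.TTheory GRing.Theory Num.Theory.
Import numFieldNormedType.Exports.
Local Open Scope classical_set_scope.
Local Open Scope ring_scope.

(** The test can only react to what it feeds to the algorithms. Pick a data
    point z and let the poisoned algorithms return, as soon as z occurs in the
    data, constant answers that favour the other side; when z does not occur they
    agree with A0 and A1. A run of the test on A0 and A1 touches finitely many
    data points, so along an infinite sequence of candidates z the test
    eventually gives the same answer for the poisoned pair, up to an event of
    arbitrarily small probability (black_box_eventually_blind,
    vanishing_events). The infinity of X or Y supplies the candidates.

    Replace P by the contamination P' = s P + (1 - s) delta_z. Since N draws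
    from P' are N draws from P with probability s^N, the rejection probability
    of the poisoned pair under P is at most s^-N times the one under P'
    (rejection_contaminated_ge). It remains to see that validity applies to the
    poisoned pair under P', which then bounds the latter by alpha.

    Comparison risk (poisoned_risk_bound): with probability about 1 - s^n the
    training sample contains z and the risk is -m, where m is the risk of a
    pair (f0, f1) that is nearly optimal for the maximal risk; otherwise it is
    that of A0 and A1, and the test point z costs at most B. With c = s^-n the
    total is nonpositive once (c - 1)(m - t B) >= Delta + t B, where
    t = s^-1 - 1 (risk_slack). The choice
    c = 1 + (Delta + b) / (Deltamax - b) makes (c - 1)(Deltamax - b) equal to
    Delta + b, and t B < b by the Bernoulli inequality unless
    alpha c^(N/n) >= 1, when there is nothing to prove (root_of_ratio).

    Stability (poisoned_stability_bound): removing the j-th point changes the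
    poisoned fit in a new way only if z is the test point or if z occurs at
    position j and nowhere else, and then the change is at most B. The
    hypothesis on gamma gives 2 B^q <= n gamma^q, and the factors s^(n+1)
    gained elsewhere pay for this (stability_slack).

    Finally s^-N = c^(N/n). *)

(** * Contaminated distributions *)

Section contamination.
Context {d} {T : measurableType d} {R : realType}.
Implicit Types (P : probability T R) (z : T) (s : R).

(** P' = s P + (1 - s) delta_z, described through integrals of nonnegative
    functions, so that it iterates over samples with the Tonelli theorem. *)
Definition contamination_of P z s (P' : probability T R) :=
  forall f : T -> \bar R, measurable_fun [set: T] f -> (forall x, 0 <= f x)%E ->
    (\int[P']_x f x = s%:E * \int[P]_x f x + (1 - s)%:E * f z)%E.

Lemma contamination_exists P z s : 0 <= s <= 1 ->
  exists P', contamination_of P z s P'.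
Proof.
move=> /andP[s0 s1].
have t0 : 0 <= 1 - s by rewrite subr_ge0.
pose mu : {measure set T -> \bar R} :=
  measure_add (mscale (NngNum s0) P) (mscale (NngNum t0) \d_z).
have muT : mu [set: T] = 1%E.
  transitivity (s%:E * P [set: T] + (1 - s)%:E * \d_z [set: T])%E.
    by rewrite /mu/= /msum/= big_ord_recl big_ord1.
  by rewrite probability_setT diracT !mule1 -EFinD addrC subrK.
pose P' : probability T R := HB.pack (mu : set T -> \bar R)
  (Measure.class mu) (Measure_isProbability.Build d T R mu muT).
exists P' => f mf f0.
transitivity (\int[mu]_x f x)%E; first by apply: eq_measure_integral.
rewrite /mu ge0_integral_measure_add// !ge0_integral_mscale//=.
by rewrite integral_dirac// diracT mul1e.
Qed.

End contamination.

(** * Independent samples *)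

Section iid_integrals.
Context {d} {T : measurableType d} {R : realType}.
Local Open Scope ereal_scope.
Implicit Types P : probability T R.

Lemma measurable_section1 {d1 d2 d3} {T1 : measurableType d1}
    {T2 : measurableType d2} {T3 : measurableType d3} (f : T1 * T2 -> T3) x :
  measurable_fun [set: T1 * T2] f -> measurable_fun [set: T2] (fun y => f (x, y)).
Proof. by move=> mf; apply: measurableT_comp => //; exact: measurable_pair1. Qed.

Lemma measurable_section2 {d1 d2 d3} {T1 : measurableType d1}
    {T2 : measurableType d2} {T3 : measurableType d3} (f : T1 * T2 -> T3) y :
  measurable_fun [set: T1 * T2] f -> measurable_fun [set: T1] (fun x => f (x, y)).
Proof. by move=> mf; apply: measurableT_comp => //; exact: measurable_pair2. Qed.

Lemma measurable_tcons_comp {d3} {T3 : measurableType d3} m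
    (f : m.+1.-tuple T -> T3) : measurable_fun [set: _] f ->
  measurable_fun [set: T * m.-tuple T] (f \o @tcons d T m).
Proof. by move=> mf; apply: measurableT_comp => //; exact: measurable_tcons. Qed.

Lemma integral_iidS P m (f : m.+1.-tuple T -> \bar R) :
  measurable_fun [set: _] f -> (forall D, 0 <= f D) ->
  \int[iid P m.+1]_D f D =
  \int[P]_x \int[iid P m]_D f (tcons (x, D)).
Proof.
move=> mf f0 /=; rewrite ge0_integral_distribution//.
rewrite fubini_tonelli1//; first exact: measurable_tcons_comp.
by move=> ?; exact: f0.
Qed.

Lemma measurable_box m (B : 'I_m -> set T) : (forall i, measurable (B i)) ->
  measurable [set D : m.-tuple T | forall i, B i (tnth D i)].
Proof.
move=> mB; rewrite (_ : [set D | _] =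
    \bigcap_(i in [set: 'I_m]) ((@tnth m T)^~ i @^-1` B i)).
  apply: fin_bigcap_measurable; first exact: finite_finset.
  by move=> i _; rewrite -[X in measurable X]setTI; exact: measurable_tnth.
by apply/seteqP; split => D /= H i; [move=> _|]; exact: H.
Qed.

Lemma iid_box P m (B : 'I_m -> set T) : (forall i, measurable (B i)) ->
  iid P m [set D | forall i, B i (tnth D i)] = \prod_(i < m) P (B i).
Proof.
elim: m B => [|m IH] B mB.
  by rewrite big_ord0 /= diracE mem_set//= => -[].
rewrite big_ord_recl -IH; last by move=> i; exact: mB.
rewrite /= /distribution /pushforward.
have mB' := measurable_box (fun i => mB (lift ord0 i)).
rewrite -(product_measure1E _ _ (mB ord0) mB').
congr (_ _); apply/seteqP; split => -[x D] /=.
  move=> H; split => [|i]; first exact: (H ord0).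
  by have := H (lift ord0 i); rewrite tnthS.
move=> [Hx HD] i; have [->|i0] := eqVneq i ord0; first exact: Hx.
have [j ->] : exists j, i = lift ord0 j.
  by have [j /= ->|] := unliftP ord0 i; [exists j|move/eqP; rewrite (negPf i0)].
by rewrite tnthS; exact: HD.
Qed.

End iid_integrals.

(** * Samples from a contaminated distribution *)

Section contaminated_samples.
Context {d} {T : measurableType d} {R : realType}.
Variables (P P' : probability T R) (z : T) (s : R).
Hypothesis s01 : 0 <= s <= 1.
Hypothesis P'E : contamination_of P z s P'.
Local Open Scope ereal_scope.

Let s0 : 0 <= s%:E.
Proof. by rewrite lee_fin; case/andP: s01. Qed.

Let t0 : 0 <= (1 - s)%:E.
Proof. by rewrite lee_fin subr_ge0; case/andP: s01. Qed.

Lemma measurable_iid_section m (mu : probability T R)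
    (f : m.+1.-tuple T -> \bar R) :
  measurable_fun [set: _] f -> (forall D, 0 <= f D) ->
  measurable_fun [set: T] (fun x => \int[iid mu m]_D f (tcons (x, D))).
Proof.
move=> mf f0.
apply: (measurable_fun_fubini_tonelli_F (f \o @tcons d T m)) => //.
- exact: measurable_tcons_comp.
- by move=> x; exact: f0.
Qed.

(** Each coordinate of a sample from P' contributes at least its s P part. *)
Lemma contaminated_iid_ge m (f : m.-tuple T -> \bar R) :
  measurable_fun [set: _] f -> (forall D, 0 <= f D) ->
  (s ^+ m)%:E * \int[iid P m]_D f D <= \int[iid P' m]_D f D.
Proof.
elim: m f => [|m IH] f mf f0; first by rewrite expr0 mul1e.
rewrite !integral_iidS// P'E//; last 2 first.
- exact: measurable_iid_section.
- by move=> x; exact: integral_ge0.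
(* the atom at z is dropped *)
rewrite -[leLHS]adde0; apply: leeD; last first.
  by apply: mule_ge0 => //; exact: integral_ge0.
rewrite exprS EFinM -muleA; apply: lee_wpmul2l => //.
rewrite -ge0_integralZl//; last 3 first.
- exact: measurable_iid_section.
- by move=> x _; exact: integral_ge0.
- by rewrite lee_fin exprn_ge0//; case/andP: s01.
apply: ge0_le_integral => //.
- by move=> x _; rewrite mule_ge0 ?integral_ge0// lee_fin exprn_ge0//; case/andP: s01.
- by apply: measurable_funeM; exact: measurable_iid_section.
- exact: measurable_iid_section.
- move=> x _; apply: IH => //.
  by have := measurable_section1 x (measurable_tcons_comp mf).
Qed.

(** A function that vanishes on the samples containing z does not see the atom
    at z in any coordinate, so only the s P parts remain. *)
Lemma contaminated_iid_le m (f : m.-tuple T -> \bar R) :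
  measurable_fun [set: _] f -> (forall D, 0 <= f D) ->
  (forall D, z \in tval D -> f D = 0) ->
  \int[iid P' m]_D f D <= (s ^+ m)%:E * \int[iid P m]_D f D.
Proof.
elim: m f => [|m IH] f mf f0 fz; first by rewrite expr0 mul1e.
rewrite !integral_iidS// P'E//; last 2 first.
- exact: measurable_iid_section.
- by move=> x; exact: integral_ge0.
have -> : \int[iid P' m]_D f (tcons (z, D)) = 0.
  by apply: integral0_eq => D _; rewrite fz//= mem_head.
rewrite mule0 adde0 exprS EFinM -muleA; apply: lee_wpmul2l => //.
rewrite -ge0_integralZl//; last 3 first.
- exact: measurable_iid_section.
- by move=> x _; exact: integral_ge0.
- by rewrite lee_fin exprn_ge0//; case/andP: s01.
apply: ge0_le_integral => //.
- by move=> x _; exact: integral_ge0.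
- exact: measurable_iid_section.
- by apply: measurable_funeM; exact: measurable_iid_section.
- move=> x _; apply: IH => //.
  + by have := measurable_section1 x (measurable_tcons_comp mf).
  + by move=> D zD; rewrite fz//= inE zD orbT.
Qed.

(** The same two bounds with an independent seed: integrate them over the
    second factor. *)
Lemma contaminated_prod_ge {dU} {U : measurableType dU} (mu : probability U R)
    m (f : m.-tuple T * U -> \bar R) :
  measurable_fun [set: _] f -> (forall w, 0 <= f w) ->
  (s ^+ m)%:E * \int[iid P m \x mu]_w f w <= \int[iid P' m \x mu]_w f w.
Proof.
move=> mf f0; rewrite !fubini_tonelli2//.
have sm0 : 0 <= (s ^+ m)%:E by rewrite lee_fin exprn_ge0//; case/andP: s01.
rewrite -ge0_integralZl//; last 2 first.
- exact: measurable_fun_fubini_tonelli_G.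
- by move=> u _; exact: integral_ge0.
apply: ge0_le_integral => //.
- by move=> u _; rewrite mule_ge0 ?integral_ge0.
- by apply: measurable_funeM; exact: measurable_fun_fubini_tonelli_G.
- exact: measurable_fun_fubini_tonelli_G.
- by move=> u _; apply: contaminated_iid_ge => //; exact: measurable_section2.
Qed.

Lemma contaminated_prod_le {dU} {U : measurableType dU} (mu : probability U R)
    m (f : m.-tuple T * U -> \bar R) :
  measurable_fun [set: _] f -> (forall w, 0 <= f w) ->
  (forall w, z \in tval w.1 -> f w = 0) ->
  \int[iid P' m \x mu]_w f w <= (s ^+ m)%:E * \int[iid P m \x mu]_w f w.
Proof.
move=> mf f0 fz; rewrite !fubini_tonelli2//.
have sm0 : 0 <= (s ^+ m)%:E by rewrite lee_fin exprn_ge0//; case/andP: s01.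
rewrite -ge0_integralZl//; last 2 first.
- exact: measurable_fun_fubini_tonelli_G.
- by move=> u _; exact: integral_ge0.
apply: ge0_le_integral => //.
- by move=> u _; exact: integral_ge0.
- exact: measurable_fun_fubini_tonelli_G.
- by apply: measurable_funeM; exact: measurable_fun_fubini_tonelli_G.
- move=> u _; apply: contaminated_iid_le => //; first exact: measurable_section2.
  by move=> D zD; rewrite /= fz.
Qed.

Lemma contaminated_measure (A : set T) : measurable A ->
  P' A = s%:E * P A + (1 - s)%:E * (\1_A z)%:E.
Proof.
move=> mA; have := P'E (f := EFin \o \1_A).
rewrite !integral_indic// !setIT; apply => [|x].
  exact/measurable_EFinP.
by rewrite /= lee_fin.
Qed.

End contaminated_samples.

(** * Events that occur finitely often *)

Section vanishing.
Context {d} {T : measurableType d} {R : realType}.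

(** The tail unions decrease to the empty set, so continuity from above makes
    their measures small. It is applied both to the atoms of P at the candidate
    points and to the events where the test tells the poisoned pair apart. *)
Lemma vanishing_events (mu : probability T R) (F : nat -> set T) :
  (forall i, measurable (F i)) ->
  (forall x, exists k, forall i, (k <= i)%N -> ~ F i x) ->
  forall e : R, 0 < e ->
    exists k, forall i, (k <= i)%N -> (mu (F i) <= e%:E)%E.
Proof.
move=> mF Fx e e0.
(* the outcomes lying in some F i with i >= k *)
pose G k := \bigcup_(i in [set i | (k <= i)%N]) F i.
have mG k : measurable (G k) by apply: bigcup_measurable => i _; exact: mF.
have G0 : \bigcap_k G k = set0.
  rewrite -subset0 => x Gx; have [k Fk] := Fx x.
  by have [i /= ki Fi] := Gx k I; exact: (Fk i).
have cG : mu (G k) @[k --> \oo] --> mu (\bigcap_k G k).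
  apply: nonincreasing_cvg_mu => //.
  - exact: (le_lt_trans (probability_le1 mu (mG 0%N)) (ltry _)).
  - by rewrite G0.
  - move=> a b ab; apply/subsetPset => x [i /= bi Fi].
    by exists i => //=; exact: leq_trans bi.
rewrite G0 measure0 in cG.
have /cG[k _ Hk] : nbhs (0%E : \bar R) [set y | (y < e%:E)%E].
  by apply: open_nbhs_nbhs; split => /=; [exact: open_ereal_lt_ereal|rewrite lte_fin].
exists k => i ki; apply: (@le_trans _ _ (mu (G k))); last exact: (ltW (Hk k (leqnn k))).
by apply: le_measure; rewrite ?inE// => x Fix; exists i.
Qed.

Lemma notin_boxE m (z : T) : [set D : m.-tuple T | z \notin tval D] =
  [set D | forall i, (~` [set z]) (tnth D i)].
Proof.
apply/seteqP; split => D /=.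
  by move=> zD i; apply: contraNnot zD => <-; exact: mem_tnth.
by move=> H; apply/negP => /tnthP[i zE]; exact: (H i).
Qed.

Lemma measurable_notin m (z : T) : measurable [set z] ->
  measurable [set D : m.-tuple T | z \notin tval D].
Proof.
move=> mz; rewrite notin_boxE.
by apply: (@measurable_box _ _ _ (fun=> ~` [set z])) => i; exact: measurableC.
Qed.

Lemma measurable_mem_sample m (z : T) : measurable [set z] ->
  measurable_fun [set: m.-tuple T] (fun D : m.-tuple T => z \in tval D).
Proof.
move=> mz; apply: (measurable_fun_bool false) => //.
rewrite setTI (_ : _ @^-1` _ = [set D : m.-tuple T | z \notin tval D]).
  exact: measurable_notin.
by apply/seteqP; split => D /=; [move=> ->|move/negbTE].
Qed.

Lemma iid_notin (P : probability T R) m z (r : R) : measurable [set z] ->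
  P (~` [set z]) = r%:E -> iid P m [set D | z \notin tval D] = (r ^+ m)%:E.
Proof.
move=> mz Pz; rewrite notin_boxE (@iid_box _ _ _ P _ (fun=> ~` [set z])).
  under eq_bigr do rewrite Pz.
  by elim: m => [|m IH]; rewrite ?big_ord0// big_ord_recl IH -EFinM exprS.
by move=> i; exact: measurableC.
Qed.

End vanishing.

Lemma infinite_injective_sequence (T : pointedType) : infinite_set [set: T] ->
  exists u : nat -> T, injective u.
Proof.
move=> /infiniteP/pcard_leTP/unsquash f.
by exists f => i j; apply: (@inj _ _ _ f); rewrite !inE.
Qed.

(** * Poisoned algorithms and the blindness of black-box tests *)

Section poisoning.
Context {dX dY dH : measure_display} {X : measurableType dX}
  {Y : measurableType dY} {Yh : measurableType dH} {R : realType}.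
Implicit Types (A : algorithm X Y Yh R) (g : {mfun X >-> Yh}).

(** A behaves as before unless the training data contain z, which triggers the
    fixed model g. *)
Definition poisoned_fit z g A (D : seq (X * Y)) (xi : seed R) :=
  if z \in D then g else A D xi.

Lemma measurable_poisoned_fit z g A : measurable [set z] -> forall m : nat,
  measurable_fun [set: (m.-tuple (X * Y) * seed R) * X]
    (fun w : (m.-tuple (X * Y) * seed R) * X =>
       poisoned_fit z g A w.1.1 w.1.2 w.2).
Proof.
move=> mz m.
rewrite (_ : (fun w => _) = fun w : (m.-tuple (X * Y) * seed R) * X =>
    if z \in tval w.1.1 then g w.2 else A w.1.1 w.1.2 w.2); last first.
  by apply/funext => w; rewrite /poisoned_fit; case: ifP.
apply: measurable_fun_ifT; last exact: measurable_fit.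
  apply: (measurableT_comp (measurable_mem_sample mz)).
  by apply: measurableT_comp.
by apply: measurableT_comp.
Qed.

Definition poisoned z (mz : measurable [set z]) g A : algorithm X Y Yh R :=
  Algorithm (measurable_poisoned_fit g A mz).

(** The test chooses its next data set from the stages already recorded. As long
    as no recorded data set contains z, both runs record the same models, hence
    make the same next choice. *)
Lemma eq_run_avoiding gen (A0 A1 B0 B1 : algorithm X Y Yh R) z D w r :
  (forall E xi, z \notin E -> B0 E xi = A0 E xi /\ B1 E xi = A1 E xi) ->
  (forall s, s \in [seq stage_data t | t <- run gen A0 A1 D w r] -> z \notin s) ->
  forall s, (s <= r)%N -> run gen B0 B1 D w s = run gen A0 A1 D w s.
Proof.
move=> BA; elim: r => [|r IH] zr s; first by rewrite leqn0 => /eqP ->.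
have run_r t : (t <= r)%N -> run gen B0 B1 D w t = run gen A0 A1 D w t.
  apply: IH => E Er; apply: zr => /=.
  by case: (gen _ _ _ _) => Dr xi; rewrite map_rcons mem_rcons inE Er orbT.
rewrite leq_eqVlt => /predU1P[->{s}|]; last exact: run_r.
move: zr => /=; rewrite run_r//; case: (gen _ _ _ _) => Dr xi zr.
have /(BA _ xi)[-> ->//] : z \notin Dr.
by apply: zr; rewrite map_rcons mem_rcons mem_head.
Qed.

(** A terminated run uses finitely many data points, so an injective sequence
    leaves them after some index; from then on the two runs have the same stages,
    stop at the same time and return the same answer. *)
Lemma black_box_eventually_blind
    (T : algorithm X Y Yh R -> algorithm X Y Yh R -> seq (X * Y) -> seeds R -> bool)
    (A0 A1 : algorithm X Y Yh R) (u : nat -> X * Y)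
    (B0 B1 : nat -> algorithm X Y Yh R) D w :
  black_box_test T -> injective u ->
  (forall i E xi, u i \notin E -> B0 i E xi = A0 E xi /\ B1 i E xi = A1 E xi) ->
  exists k, forall i, (k <= i)%N -> T (B0 i) (B1 i) D w = T A0 A1 D w.
Proof.
move=> [[gen [stop [out Tout]]] _] uinj BA.
have [r [r0 stopr Nstop ->]] := Tout A0 A1 D w.
(* all data points used by the run on (A0, A1) *)
pose L := flatten [seq stage_data t | t <- run gen A0 A1 D w r].
have [k uk] : exists k, forall i, (k <= i)%N -> u i \notin L.
  elim: L => [|x L [k Hk]]; first by exists 0%N.
  have [[j uj]|Nu] := pselect (exists j, u j = x).
    exists (maxn k j.+1) => i; rewrite geq_max => /andP[ki ji].
    rewrite inE negb_or Hk// andbT -uj; apply: contraTneq ji => /uinj ->.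
    by rewrite ltnn.
  exists k => i ki; rewrite inE negb_or Hk// andbT.
  by apply/eqP => ux; apply: Nu; exists i.
exists k => i /uk uL.
have runE s : (s <= r)%N -> run gen (B0 i) (B1 i) D w s = run gen A0 A1 D w s.
  apply: (@eq_run_avoiding _ _ _ _ _ (u i)) => [E xi|E Er]; first exact: BA.
  by apply: contra uL => uE; apply/flattenP; exists E.
have [r' [r'0 stopr' Nstop' ->]] := Tout (B0 i) (B1 i) D w.
suff -> : r' = r by rewrite runE.
(* the first stopping time is determined by the common stages *)
have [rr'|r'r|//] := ltngtP r' r.
  by have := Nstop r'; rewrite r'0 rr' -runE 1?ltnW// stopr' => /(_ isT).
by have := Nstop' r; rewrite r0 r'r runE// stopr => /(_ isT).
Qed.

End poisoning.

(** * Choice of the contamination level *)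

Section arithmetic.
Context {R : realType}.
Implicit Types (s x y c : R) (n m N q : nat).

Lemma bernoulli_inequality x n : -1 <= x -> 1 + n%:R * x <= (1 + x) ^+ n.
Proof.
move=> x1; elim: n => [|n IH]; first by rewrite mul0r addr0 expr0.
have x0 : 0 <= 1 + x by lra.
rewrite exprS; apply: le_trans (ler_wpM2l x0 IH).
have n0 : 0 <= n%:R * x ^+ 2 by rewrite mulr_ge0// sqr_ge0.
by rewrite -natr1; nra.
Qed.

(** 1 - s^(m+2) is (1 - s) times the sum of s^i for i <= m + 1, in which the
    first m + 1 terms are at least s^m. *)
Lemma geometric_gap s m : 0 < s -> s <= 1 ->
  (1 - s) * (m.+1%:R * s ^+ m + s ^+ m.+1) <= 1 - s ^+ m.+2.
Proof.
move=> s0 s1; elim: m => [|m IH]; first by rewrite expr0 expr1 expr2 mul1r; lra.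
have y0 : 0 < s ^+ m by exact: exprn_gt0.
move: IH; rewrite !exprS -(natr1 m.+1); set y := s ^+ m in y0 *.
have m0 : 0 <= m.+1%:R :> R by [].
set k : R := m.+1%:R in m0 *.
have : 0 <= (1 - s) * (k * y * (1 - s)).
  by rewrite !mulr_ge0//; lra.
by move=> *; nra.
Qed.

(** With n = m + 1, G = gamma^q and K = B^q the left-hand side bounds the q-th
    stability moment of a poisoned algorithm under the contamination, p being
    the mass of P at z. By the previous lemma it is strictly below G when
    p = 0, which leaves room for a small atom. *)
Lemma stability_slack s m (K G : R) : 0 < s < 1 -> 0 < G ->
  0 <= K -> 2 * K <= m.+1%:R * G ->
  exists2 e : R, 0 < e & forall p, 0 <= p <= 1 -> p <= e ->
    s ^+ m.+2 * G +
      ((1 - s) * s ^+ m.+1 + (1 - s * (1 - p)) * (s * (1 - p)) ^+ m) * K <= G.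
Proof.
move=> /andP[s0 s1] G0 K0 KG.
have y0 : 0 < s ^+ m by exact: exprn_gt0.
have y1 : s ^+ m <= 1 by apply: exprn_ile1; exact: ltW.
have := geometric_gap m s0 (ltW s1).
rewrite !exprS; set y := s ^+ m in y0 y1 *; set k : R := m.+1%:R in KG *.
have k0 : 0 < k by rewrite ltr0n.
move=> gap.
exists ((1 - s) * y * s / k).
  by rewrite divr_gt0// !mulr_gt0//; lra.
move=> p /andP[p0 p1]; rewrite ler_pdivlMr// => pk.
have r0 : 0 <= s * (1 - p) by rewrite mulr_ge0 ?(ltW s0)// subr_ge0.
have sp : s * p <= p by rewrite ler_piMl// ltW.
have ps : s * (1 - p) <= s by rewrite ler_piMr ?(ltW s0)//; lra.
set w := (1 - s) * (s * y) + (1 - s + p) * y.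
have rw : (1 - s * (1 - p)) * (s * (1 - p)) ^+ m <= (1 - s + p) * y.
  apply: ler_pM; rewrite ?exprn_ge0//; [lra|lra|].
  by apply: lerXn2r; rewrite ?nnegrE// (ltW s0).
apply: (@le_trans _ _ (s * (s * y) * G + w * K)).
  by rewrite lerD2l ler_wpM2r// lerD2l.
have w0 : 0 <= w by rewrite addr_ge0 ?mulr_ge0//; nra.
have wK : w * (2 * K) <= w * (k * G) by exact: ler_wpM2l.
suff H : 2 * (s * (s * y)) + w * k <= 2.
  have : G * (2 * (s * (s * y)) + w * k) <= G * 2 by rewrite ler_pM2l.
  by move=> HG; nra.
have py : p * k * y <= (1 - s) * y * s.
  apply: le_trans (_ : p * k <= _) => //.
  by rewrite ler_piMr// mulr_ge0// ltW.
have kk : 0 <= k * y * (1 - s) * (1 - s) by rewrite !mulr_ge0//; lra.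
have yy : 0 <= (1 - s) * y * s by rewrite !mulr_ge0//; lra.
rewrite /w; nra.
Qed.

(** The left-hand side bounds the comparison risk of the poisoned pair, shifted
    by B. For p = 0 the inequality is strict by the assumed gap, the difference
    being s s^n times that gap; a small atom p of P at z changes it by a term
    that the Bernoulli inequality makes linear in p. *)
Lemma risk_slack s n c (B D m : R) : 0 < s <= 1 -> 1 < c -> s ^+ n * c = 1 ->
  m <= B ->
  D + (s^-1 - 1) * B < (c - 1) * (m - (s^-1 - 1) * B) ->
  exists2 e : R, 0 < e & forall p, 0 <= p <= 1 -> p <= e ->
    2 * (1 - s) * B +
      s * ((1 - (s * (1 - p)) ^+ n) * (B - m) + s ^+ n * (D + B)) <= B.
Proof.
move=> /andP[s0 s1] c1 sc mB H.
have y0 : 0 < s ^+ n by exact: exprn_gt0.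
have y1 : s ^+ n <= 1 by apply: exprn_ile1 => //; exact: ltW.
set y := s ^+ n in sc y0 y1 *.
have n0 : 0 <= n%:R * (B - m) by rewrite mulr_ge0// subr_ge0.
(* the gap left by the hypothesis *)
pose g := (c - 1) * (m - (s^-1 - 1) * B) - (D + (s^-1 - 1) * B).
have g0 : 0 < g by rewrite subr_gt0.
have sV : s * s^-1 = 1 by rewrite mulfV ?gt_eqF.
have E0 : 2 * (1 - s) * B + s * ((1 - y) * (B - m) + y * (D + B)) =
    B - s * y * g.
  have -> : s * y * g = (s * (y * c) - s * y) * m -
      (y * c) * (s * s^-1 - s) * B - s * y * D.
    by rewrite /g; ring.
  by rewrite sc sV; ring.
exists (g / (n%:R * (B - m) + 1)); first by rewrite divr_gt0//; lra.
move=> p /andP[p0 p1]; rewrite ler_pdivlMr; last lra.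
move=> pg.
have := @bernoulli_inequality (- p) n; rewrite lerN2 => /(_ p1).
rewrite mulrN exprMn -/y => bern.
have yb : y * (1 - n%:R * p) * (B - m) <= y * (1 - p) ^+ n * (B - m).
  by rewrite ler_wpM2r ?subr_ge0// ler_wpM2l// ltW.
have : s * ((1 - y * (1 - p) ^+ n) * (B - m)) <=
    s * ((1 - y * (1 - n%:R * p)) * (B - m)).
  by rewrite ler_wpM2l ?(ltW s0)// [in leRHS]mulrBl [in leLHS]mulrBl lerB.
have : s * y * (p * (n%:R * (B - m))) <= s * y * g.
  rewrite ler_wpM2l ?mulr_ge0 ?(ltW s0) ?(ltW y0)//; apply: le_trans pg.
  by rewrite ler_wpM2l// lerDl.
by move=> h1 h2; lra.
Qed.

(** Take s = c^(-1/n). If s^-1 - 1 reached (alpha^-1 - 1) / N, the Bernoulli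
    inequality would give c^(N/n) = s^-N >= alpha^-1, against the assumption. *)
Lemma root_of_ratio c n N (alpha : R) : 1 < c -> (0 < n)%N -> (0 < N)%N ->
  0 < alpha -> alpha * c `^ (N%:R / n%:R) < 1 ->
  exists s : R, [/\ 0 < s < 1, s ^+ n * c = 1,
    (s ^+ N)^-1 = c `^ (N%:R / n%:R) & s^-1 - 1 < (alpha^-1 - 1) / N%:R].
Proof.
move=> c1 n0 N0 a0 aN.
have c0 : 0 < c by lra.
have nR : n%:R != 0 :> R by rewrite pnatr_eq0 -lt0n.
have NR : 0 < N%:R :> R by rewrite ltr0n.
pose v := c `^ n%:R^-1.
have v0 : 0 < v by exact: powR_gt0.
have vn : v ^+ n = c by rewrite -powR_mulrn ?ltW// -powRrM mulVf// powRr1// ltW.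
have vN : v ^+ N = c `^ (N%:R / n%:R).
  by rewrite -powR_mulrn ?ltW// -powRrM mulrC.
have v1 : 1 < v.
  rewrite ltNge; apply/negP => vle.
  have : v ^+ n <= 1 by apply: exprn_ile1 => //; exact: ltW.
  by rewrite vn leNgt c1.
exists v^-1; split.
- by rewrite invr_gt0 v0 invf_lt1.
- by rewrite exprVn vn mulVf// gt_eqF.
- by rewrite exprVn invrK.
- rewrite invrK ltNge; apply/negP => xv.
  have a1 : 0 < alpha^-1 by rewrite invr_gt0.
  pose x := (alpha^-1 - 1) / N%:R.
  have x1 : -1 <= x.
    rewrite ler_pdivlMr// mulN1r; have : 1 <= N%:R :> R by rewrite ler1n.
    by lra.
  have := bernoulli_inequality N x1.
  have -> : 1 + N%:R * x = alpha^-1.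
    by rewrite /x mulrCA divff ?gt_eqF// mulr1; ring.
  have : (1 + x) ^+ N <= v ^+ N.
    by rewrite lerXn2r ?nnegrE//; [lra|lra|rewrite -/x in xv; lra].
  rewrite vN => h1 h2; have := le_trans h2 h1.
  by rewrite -div1r ler_pdivrMr// mulrC leNgt aN.
Qed.

(** Raising the lower bound on gamma to the power q gives
    2^q B^q <= (n + 1) gamma^q, and 2 <= 2^q. *)
Lemma loss_power_bound (B gamma : R) q n : q = 1%N \/ q = 2%N -> 0 <= B ->
  2 * B / (n.+1%:R `^ (q%:R^-1)) <= gamma -> 2 * B ^+ q <= n.+1%:R * gamma ^+ q.
Proof.
move=> q12 B0; have n0 : 0 < n.+1%:R :> R by rewrite ltr0n.
have d0 : 0 < n.+1%:R `^ (q%:R^-1) :> R by exact: powR_gt0.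
have dq : (n.+1%:R `^ (q%:R^-1)) ^+ q = n.+1%:R :> R.
  rewrite -powR_mulrn ?ltW// -powRrM mulVf ?powRr1 ?ltW//.
  by rewrite pnatr_eq0; case: q12 => ->.
rewrite ler_pdivrMr// => H.
have : (2 * B) ^+ q <= (gamma * n.+1%:R `^ q%:R^-1) ^+ q.
  rewrite lerXn2r ?nnegrE ?mulr_ge0//.
  by rewrite -(pmulr_lge0 _ d0); apply: le_trans H; rewrite mulr_ge0.
rewrite !exprMn dq [_ * n.+1%:R]mulrC => H2; apply: le_trans H2.
by rewrite ler_wpM2r ?exprn_ge0//; case: q12 => ->; rewrite ?expr1// expr2; lra.
Qed.

End arithmetic.

(** * Comparison risks of bounded losses *)

Section bounded_integrals.
Context {d} {T : measurableType d} {R : realType} (mu : probability T R).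
Local Open Scope ereal_scope.
Variables (f : T -> \bar R) (B : R).
Hypothesis mf : measurable_fun [set: T] f.
Hypothesis fB : forall x, `|f x| <= B%:E.

Lemma bounded_integrable_prob : mu.-integrable [set: T] f.
Proof.
apply/integrableP; split => //.
apply: (@le_lt_trans _ _ (\int[mu]_x B%:E)).
  by apply: ge0_le_integral => //; exact: measurableT_comp.
by rewrite integral_cst//= probability_setT mule1 ltry.
Qed.

Lemma integral_shift : \int[mu]_x f x + B%:E = \int[mu]_x (f x + B%:E).
Proof.
rewrite integralD//; last 2 first.
- exact: bounded_integrable_prob.
- by apply: finite_measure_integrable_cst.
by rewrite integral_cst//= probability_setT mule1.
Qed.

Lemma le_abs_integral_prob : `|\int[mu]_x f x| <= B%:E.
Proof.
apply: le_trans (le_abse_integral mu measurableT mf) _.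
apply: (@le_trans _ _ (\int[mu]_x B%:E)).
  by apply: ge0_le_integral => //; exact: measurableT_comp.
by rewrite integral_cst//= probability_setT mule1.
Qed.

End bounded_integrals.

Section comparison_risks.
Context {dX dY dH : measure_display} {X : measurableType dX}
  {Y : measurableType dY} {Yh : measurableType dH} {R : realType}.
Variables (B : R) (loss : Yh -> Y -> R) (psi : Yh -> Yh -> Y -> R).
Hypothesis hloss : forall yh y, 0 <= loss yh y <= B.
Hypothesis mloss :
  measurable_fun [set: Yh * Y] (fun p : Yh * Y => loss p.1 p.2).
Hypothesis hpsi : forall y' y'' y, psi y' y'' y = loss y' y - loss y'' y.
Implicit Types (A : algorithm X Y Yh R) (f : {mfun X >-> Yh})
  (P : probability (X * Y)%type R).
Local Open Scope ereal_scope.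

Lemma measurable_loss_model f :
  measurable_fun [set: X * Y] (fun z : X * Y => loss (f z.1) z.2).
Proof.
have mh : measurable_fun [set: X * Y] (fun z : X * Y => (f z.1, z.2)).
  by apply: measurable_fun_pair => //; exact: measurableT_comp.
exact: (measurableT_comp mloss mh).
Qed.

Lemma measurable_loss_fit A m :
  measurable_fun [set: (m.-tuple (X * Y) * seed R) * (X * Y)]
    (fun w : (m.-tuple (X * Y) * seed R) * (X * Y) =>
       loss (A w.1.1 w.1.2 w.2.1) w.2.2).
Proof.
have mx : measurable_fun [set: (m.-tuple (X * Y) * seed R) * (X * Y)]
    (fun w : (m.-tuple (X * Y) * seed R) * (X * Y) => (w.1, w.2.1)).
  by apply: measurable_fun_pair => //; exact: measurableT_comp.
have mh : measurable_fun [set: (m.-tuple (X * Y) * seed R) * (X * Y)]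
    (fun w : (m.-tuple (X * Y) * seed R) * (X * Y) =>
       (A w.1.1 w.1.2 w.2.1, w.2.2)).
  apply: measurable_fun_pair; last exact: measurableT_comp.
  exact: (measurableT_comp (measurable_fit A (m := m)) mx).
exact: (measurableT_comp mloss mh).
Qed.

Lemma psi_bound y' y'' y : (`|psi y' y'' y| <= B)%R.
Proof.
have := hloss y' y; have := hloss y'' y.
by rewrite hpsi ler_norml; move=> /andP[? ?] /andP[? ?]; apply/andP; split; lra.
Qed.

Lemma measurable_psi_model f0 f1 :
  measurable_fun [set: X * Y] (fun z : X * Y => psi (f0 z.1) (f1 z.1) z.2).
Proof.
rewrite (_ : (fun z => _) =
    fun z : X * Y => (loss (f0 z.1) z.2 - loss (f1 z.1) z.2)%R).
  by apply: measurable_funB; exact: measurable_loss_model.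
by apply/funext => z; rewrite hpsi.
Qed.

Lemma measurable_psi_fit A0 A1 m :
  measurable_fun [set: (m.-tuple (X * Y) * seed R) * (X * Y)]
    (fun w : (m.-tuple (X * Y) * seed R) * (X * Y) =>
       psi (A0 w.1.1 w.1.2 w.2.1) (A1 w.1.1 w.1.2 w.2.1) w.2.2).
Proof.
rewrite (_ : (fun w => _) = fun w : (m.-tuple (X * Y) * seed R) * (X * Y) =>
    (loss (A0 w.1.1 w.1.2 w.2.1) w.2.2 - loss (A1 w.1.1 w.1.2 w.2.1) w.2.2)%R).
  by apply: measurable_funB; exact: measurable_loss_fit.
by apply/funext => w; rewrite hpsi.
Qed.

(** Adding B turns comparison risks into integrals of nonnegative functions, for
    which the Tonelli theorem and the contamination formula apply. *)
Lemma comparison_risk_shift P f0 f1 :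
  comparison_risk psi P f0 f1 + B%:E =
  \int[P]_z (psi (f0 z.1) (f1 z.1) z.2 + B)%:E.
Proof.
rewrite /comparison_risk unlock integral_shift//.
- by apply/measurable_EFinP; exact: measurable_psi_model.
- by move=> z; rewrite lee_fin psi_bound.
Qed.

Lemma comparison_risk_bound P f0 f1 : `|comparison_risk psi P f0 f1| <= B%:E.
Proof.
rewrite /comparison_risk unlock; apply: le_abs_integral_prob => //.
- by apply/measurable_EFinP; exact: measurable_psi_model.
- by move=> z; rewrite lee_fin psi_bound.
Qed.

Lemma comparison_risk_fin P f0 f1 : comparison_risk psi P f0 f1 \is a fin_num.
Proof.
by rewrite fin_num_abs (le_lt_trans (comparison_risk_bound _ _ _))// ltry.
Qed.

Lemma comparison_riskN P f0 f1 :
  comparison_risk psi P f1 f0 = - comparison_risk psi P f0 f1.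
Proof.
rewrite /comparison_risk unlock -integralN//; last first.
  apply: integrable_add_def => //.
  apply: bounded_integrable_prob.
    by apply/measurable_EFinP; exact: measurable_psi_model.
  by move=> z; rewrite lee_fin; exact: psi_bound.
apply: eq_integral => z _.
by rewrite -EFinN !hpsi opprB.
Qed.

Lemma measurable_shifted_risk P A0 A1 m :
  measurable_fun [set: m.-tuple (X * Y) * seed R]
    (fun w : m.-tuple (X * Y) * seed R =>
      \int[P]_z (psi (A0 w.1 w.2 z.1) (A1 w.1 w.2 z.1) z.2 + B)%:E).
Proof.
apply: (measurable_fun_fubini_tonelli_F (m2 := P)
  (fun w : (m.-tuple (X * Y) * seed R) * (X * Y) =>
    (psi (A0 w.1.1 w.1.2 w.2.1) (A1 w.1.1 w.1.2 w.2.1) w.2.2 + B)%:E)).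
  apply/measurable_EFinP; apply: measurable_funD => //.
  exact: measurable_psi_fit.
move=> w; rewrite lee_fin; have := psi_bound
  (A0 w.1.1 w.1.2 w.2.1) (A1 w.1.1 w.1.2 w.2.1) w.2.2.
by rewrite ler_norml => /andP[? _]; lra.
Qed.

Lemma measurable_fit_risk P A0 A1 m :
  measurable_fun [set: m.-tuple (X * Y) * seed R]
    (fun w : m.-tuple (X * Y) * seed R =>
      comparison_risk psi P (A0 w.1 w.2) (A1 w.1 w.2)).
Proof.
rewrite (_ : (fun w => _) = fun w : m.-tuple (X * Y) * seed R =>
    \int[P]_z (psi (A0 w.1 w.2 z.1) (A1 w.1 w.2 z.1) z.2 + B)%:E - B%:E).
  apply: emeasurable_funB => //; exact: measurable_shifted_risk.
by apply/funext => w; rewrite -comparison_risk_shift addeK.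
Qed.

Lemma algorithm_comparison_risk_shift P n A0 A1 :
  algorithm_comparison_risk psi P n A0 A1 + B%:E =
  \int[iid P n \x unif01 R]_w
    \int[P]_z (psi (A0 w.1 w.2 z.1) (A1 w.1 w.2 z.1) z.2 + B)%:E.
Proof.
rewrite /algorithm_comparison_risk integral_shift.
- by apply: eq_integral => w _; exact: comparison_risk_shift.
- exact: measurable_fit_risk.
- by move=> w; exact: comparison_risk_bound.
Qed.

Lemma algorithm_comparison_risk_fin P n A0 A1 :
  algorithm_comparison_risk psi P n A0 A1 \is a fin_num.
Proof.
rewrite fin_num_abs; apply: (@le_lt_trans _ _ B%:E); last exact: ltry.
apply: le_abs_integral_prob; first exact: measurable_fit_risk.
by move=> w; exact: comparison_risk_bound.
Qed.

Lemma max_comparison_risk_le P : max_comparison_risk psi P <= B%:E.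
Proof.
apply: ge_ereal_sup => _ [f _ <-].
exact: le_trans (lee_abs _) (comparison_risk_bound _ _ _).
Qed.

End comparison_risks.

(** * Comparison risk of the poisoned pair *)

Section poisoned_risk.
Context {dX dY dH : measure_display} {X : measurableType dX}
  {Y : measurableType dY} {Yh : measurableType dH} {R : realType}.
Variables (B : R) (loss : Yh -> Y -> R) (psi : Yh -> Yh -> Y -> R).
Hypothesis hloss : forall yh y, 0 <= loss yh y <= B.
Hypothesis mloss :
  measurable_fun [set: Yh * Y] (fun p : Yh * Y => loss p.1 p.2).
Hypothesis hpsi : forall y' y'' y, psi y' y'' y = loss y' y - loss y'' y.
Variables (P P' : probability (X * Y)%type R) (z : X * Y) (s r : R).
Hypothesis s01 : 0 <= s <= 1.
Hypothesis mz : measurable [set z].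
Hypothesis P'E : contamination_of P z s P'.
Hypothesis P'z : P' (~` [set z]) = r%:E.
Local Open Scope ereal_scope.

Lemma prod_setXT {d1 d2} {T1 : measurableType d1} {T2 : measurableType d2}
    (mu1 : probability T1 R) (mu2 : probability T2 R) (E : set T1) :
  measurable E -> (mu1 \x mu2) [set w | E w.1] = mu1 E.
Proof.
move=> mE; rewrite (_ : [set w | E w.1] = E `*` [set: T2]).
  by rewrite product_measure1E//= probability_setT mule1.
by apply/seteqP; split => w //= [].
Qed.

Lemma shifted_psi_ge0 y' y'' y : (0 <= psi y' y'' y + B)%R.
Proof.
by have := psi_bound hloss hpsi y' y'' y; rewrite ler_norml => /andP[? _]; lra.
Qed.

(** Note the exchange of f0 and f1 in the poisoned pair: on the samples that
    contain z the risk is -m. On the others, only the s P parts count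
    (contaminated_prod_le), which gives s^n times the shifted risk of A0 and A1.
    A test point equal to z costs at most 2 B after the shift. *)
Lemma poisoned_risk_bound (n : nat) (f0 f1 : {mfun X >-> Yh})
    (A0 A1 : algorithm X Y Yh R) (m D : R) :
  comparison_risk psi P f0 f1 = m%:E ->
  algorithm_comparison_risk psi P n A0 A1 = D%:E ->
  algorithm_comparison_risk psi P' n (poisoned mz f1 A0) (poisoned mz f0 A1)
    + B%:E <=
  (2 * (1 - s) * B + s * ((1 - r ^+ n) * (B - m) + s ^+ n * (D + B)))%:E.
Proof.
move=> mE DE.
have B0 : (0 <= B)%R.
  have := comparison_risk_bound hloss mloss hpsi P f0 f1.
  by rewrite mE lee_fin; exact: le_trans.
have mB : (m <= B)%R.
  have := comparison_risk_bound hloss mloss hpsi P f0 f1.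
  by rewrite mE lee_fin ler_norml => /andP[].
have [s0 t0] : (0 <= s)%R /\ (0 <= 1 - s)%R by move/andP: s01 => [? ?]; lra.
rewrite (algorithm_comparison_risk_shift hloss mloss hpsi).
(* the samples that contain z, and the shifted risk of A0 and A1 *)
pose Z : set (n.-tuple (X * Y) * seed R) := [set w | z \in tval w.1].
pose H (w : n.-tuple (X * Y) * seed R) :=
  \int[P]_x (psi (A0 w.1 w.2 x.1) (A1 w.1 w.2 x.1) x.2 + B)%:E.
have mZ : measurable Z.
  have := measurable_mem_sample (m := n) mz => mzn.
  have : measurable_fun [set: n.-tuple (X * Y) * seed R]
      (fun w : n.-tuple (X * Y) * seed R => z \in tval w.1).
    exact: (measurableT_comp mzn).
  move=> /(_ measurableT [set true]); rewrite setTI; exact.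
have mH : measurable_fun [set: n.-tuple (X * Y) * seed R] H.
  exact: (measurable_shifted_risk hloss mloss hpsi).
have H0 w : 0 <= H w.
  by apply: integral_ge0 => x _; rewrite lee_fin shifted_psi_ge0.
have m1 (E : set (n.-tuple (X * Y) * seed R)) : measurable E ->
    measurable_fun [set: n.-tuple (X * Y) * seed R] (EFin \o \1_E : _ -> \bar R).
  by move=> mE'; apply/measurable_EFinP.
have muZ : (iid P' n \x unif01 R) Z = (1 - r ^+ n)%:E.
  have mNz := measurable_notin (m := n) mz.
  rewrite (_ : Z = [set w | (~` [set D | z \notin tval D]) w.1]).
    rewrite prod_setXT; last exact: measurableC.
    by rewrite probability_setC// (iid_notin n mz P'z) -EFinB.
  apply/seteqP; split => w /=; first by move=> zw /negP; exact.
  by move=> /negP; rewrite negbK.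
pose g1 w := (B - m)%:E * (\1_Z w)%:E.
pose g2 w := H w * (\1_(~` Z) w)%:E.
have mg1 : measurable_fun [set: n.-tuple (X * Y) * seed R] g1.
  by apply: measurable_funeM; exact: m1.
have mg2 : measurable_fun [set: n.-tuple (X * Y) * seed R] g2.
  by apply: emeasurable_funM => //; apply: m1; exact: measurableC.
have g10 w : 0 <= g1 w by rewrite mule_ge0// lee_fin// subr_ge0.
have g20 w : 0 <= g2 w by rewrite mule_ge0// lee_fin.
apply: (@le_trans _ _ (\int[iid P' n \x unif01 R]_w
    ((2 * (1 - s) * B)%:E + s%:E * (g1 w + g2 w)))).
  apply: ge0_le_integral => //.
  - by move=> w _; apply: integral_ge0 => x _; rewrite lee_fin shifted_psi_ge0.
  - exact: (measurable_shifted_risk hloss mloss hpsi).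
  - apply: emeasurable_funD => //; apply: measurable_funeM.
    exact: emeasurable_funD.
  move=> w _; rewrite P'E; last 2 first.
  - apply/measurable_EFinP; apply: measurable_funD => //.
    exact: (measurable_psi_model mloss hpsi).
  - by move=> x; rewrite lee_fin shifted_psi_ge0.
  (* split the test point into its atom at z and its s P part *)
  rewrite addeC; apply: leeD.
    rewrite -EFinM lee_fin; set a := psi _ _ _.
    have : (`|a| <= B)%R by exact: (psi_bound hloss hpsi).
    rewrite ler_norml => /andP[_ aB].
    have -> : (2 * (1 - s) * B = (1 - s) * (B + B))%R by ring.
    by rewrite ler_wpM2l// lerD2r.
  apply: lee_wpmul2l; first by rewrite lee_fin.
  rewrite /g1 /g2 /H /poisoned/= /poisoned_fit.
  have [zw|zw] := boolP (z \in tval w.1).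
    rewrite !indicE mem_set// memNset//=.
    rewrite mule0 adde0 mule1 -(comparison_risk_shift hloss mloss hpsi).
    by rewrite (comparison_riskN hloss mloss hpsi) mE -EFinN -EFinD addrC.
  rewrite !indicE memNset; last exact/negP.
  by rewrite mem_set ?mule0 ?add0e ?mule1//; exact/negP.
rewrite ge0_integralD//; last 3 first.
- by move=> w _; rewrite lee_fin !mulr_ge0.
- by move=> w _; rewrite mule_ge0 ?lee_fin// adde_ge0.
- by apply: measurable_funeM; exact: emeasurable_funD.
rewrite integral_cst//= probability_setT mule1 [leRHS]EFinD leeD2l//.
rewrite ge0_integralZl//; last 2 first.
- exact: emeasurable_funD.
- by move=> w _; rewrite adde_ge0.
rewrite [leRHS]EFinM lee_wpmul2l// ?lee_fin//.
rewrite ge0_integralD// [leRHS]EFinD leeD//.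
  rewrite ge0_integralZl//; last 2 first.
  - exact: m1.
  - by rewrite lee_fin subr_ge0.
  rewrite integral_indic// setIT muleC EFinM lee_wpmul2r ?lee_fin ?subr_ge0//.
  by rewrite -muZ.
(* g2 vanishes on the samples that contain z *)
apply: (le_trans (contaminated_prod_le s01 P'E (unif01 R) mg2 g20 _)).
  by move=> w zw; rewrite /g2 indicE memNset ?mule0//= => /(_ zw).
rewrite EFinM lee_wpmul2l ?lee_fin ?exprn_ge0// EFinD -DE.
rewrite (algorithm_comparison_risk_shift hloss mloss hpsi).
apply: ge0_le_integral => // w _.
by rewrite /g2 -[leRHS]mule1 lee_wpmul2l// lee_fin indicE; case: (_ \in _).
Qed.

End poisoned_risk.

(** * Stability of a poisoned algorithm *)

Lemma tonelli_triple {d1 d2 d3} {T1 : measurableType d1} {T2 : measurableType d2}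
    {T3 : measurableType d3} {R : realType} (mu1 : probability T1 R)
    (mu2 : probability T2 R) (mu3 : probability T3 R)
    (f : (T1 * T2) * T3 -> \bar R) :
  measurable_fun [set: (T1 * T2) * T3] f -> (forall w, 0 <= f w)%E ->
  (\int[(mu1 \x mu2) \x mu3]_w f w =
   \int[mu1 \x mu2]_w \int[mu3]_x f (w, x))%E.
Proof.
move=> mf f0.
(* naming the product as a probability settles its sigma-finiteness *)
pose mu12 : probability (T1 * T2)%type R := (mu1 \x mu2)%E.
exact: (@fubini_tonelli1 _ _ _ _ R mu12 mu3 f mf f0).
Qed.

Section stability_moments.
Context {d} {T : measurableType d} {R : realType}.
Local Open Scope ereal_scope.

Lemma Lnorm_natr_le (mu : {measure set T -> \bar R}) (f : T -> R) (q : nat)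
    (gamma : R) : (0 < q)%N -> (0 <= gamma)%R ->
  'N[mu]_q%:R%:E[(fun x => (f x)%:E)] <= gamma%:E <->
  \int[mu]_x (`|f x| ^+ q)%:E <= (gamma ^+ q)%:E.
Proof.
move=> q0 g0; have qR : (0 < q%:R :> R)%R by rewrite ltr0n.
have qN0 : (q%:R != 0 :> R)%R by rewrite gt_eqF.
rewrite unlock /=.
rewrite (eq_integral (fun x => (`|f x| ^+ q)%:E)); last first.
  by move=> x _ /=; rewrite powR_mulrn.
set I := \int[mu]_x _.
have I0 : 0 <= I by apply: integral_ge0 => x _; rewrite lee_fin exprn_ge0.
have Iin : I \in `[0, +oo] by rewrite in_itv/= I0 leey.
have pow_le := @gt0_ler_poweR R.
split=> H.
  have := pow_le q%:R (ltW qR) (I `^ q%:R^-1) gamma%:E.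
  rewrite !in_itv/= poweR_ge0 !leey lee_fin g0 => /(_ isT isT H).
  by rewrite -poweRrM mulVf// poweRe1//= powR_mulrn.
have qV : (0 <= q%:R^-1 :> R)%R by rewrite invr_ge0 ltW.
have := pow_le (q%:R^-1)%R qV I (gamma ^+ q)%:E.
rewrite Iin in_itv/= lee_fin exprn_ge0// leey.
move=> /(_ isT isT H); rewrite /= -powR_mulrn// -powRrM.
by rewrite divff// powRr1.
Qed.

End stability_moments.

Section leave_one_out.
Context {dX dY dH : measure_display} {X : measurableType dX}
  {Y : measurableType dY} {Yh : measurableType dH} {R : realType}.
Variables (B : R) (loss : Yh -> Y -> R).
Hypothesis hloss : forall yh y, 0 <= loss yh y <= B.
Hypothesis mloss :
  measurable_fun [set: Yh * Y] (fun p : Yh * Y => loss p.1 p.2).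
Implicit Types (A : algorithm X Y Yh R) (P : probability (X * Y)%type R).
Local Open Scope ereal_scope.

Definition loo_power q A n (j : 'I_n)
    (w : (n.-tuple (X * Y) * seed R) * (X * Y)) : R :=
  (`|loss (A w.1.1 w.1.2 w.2.1) w.2.2
     - loss (A (leave_out w.1.1 j) w.1.2 w.2.1) w.2.2| ^+ q)%R.

Lemma loo_power_ge0 q A n (j : 'I_n) w : (0 <= loo_power q A j w)%R.
Proof. exact: exprn_ge0. Qed.

Lemma loo_power_le q A n (j : 'I_n) w : (loo_power q A j w <= B ^+ q)%R.
Proof.
rewrite /loo_power; set a := loss _ _; set b := loss _ _.
have : (0 <= a <= B)%R by exact: hloss.
have : (0 <= b <= B)%R by exact: hloss.
move=> /andP[b0 bB] /andP[a0 aB].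
apply: lerXn2r; rewrite ?nnegrE//; first lra.
by rewrite ler_norml; apply/andP; split; lra.
Qed.

Lemma measurable_loo_power q A n (j : 'I_n) :
  measurable_fun [set: (n.-tuple (X * Y) * seed R) * (X * Y)]
    (loo_power q A j).
Proof.
apply: measurable_funX; apply: measurableT_comp => //.
apply: measurable_funB; first exact: measurable_loss_fit.
pose idx := in_tuple [seq i <- enum 'I_n | i != j].
pose lo (D : n.-tuple (X * Y)) := map_tuple (tnth D) idx.
have mlo : measurable_fun [set: n.-tuple (X * Y)] lo.
  apply/measurable_fun_tnthP => i.
  rewrite (_ : _ \o _ = fun D : n.-tuple (X * Y) => tnth D (tnth idx i)).
    exact: measurable_tnth.
  by apply/funext => D; rewrite /= tnth_map.
have mh : measurable_fun [set: (n.-tuple (X * Y) * seed R) * (X * Y)]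
   (fun w : (n.-tuple (X * Y) * seed R) * (X * Y) =>
      ((lo w.1.1, w.1.2), w.2)).
  apply: measurable_fun_pair => //; apply: measurable_fun_pair.
    by apply: measurableT_comp => //; exact: measurableT_comp.
  exact: measurableT_comp.
exact: (measurableT_comp (measurable_loss_fit mloss A (m := _)) mh).
Qed.

(** Stability bounds are handled through q-th moments, which are additive over
    cases, in contrast with the norms. *)
Lemma stability_le q A P n (gamma : R) : (0 < q)%N -> (0 <= gamma)%R ->
  stability loss q A P n <= gamma%:E <->
  forall j : 'I_n, \int[(iid P n \x unif01 R) \x P]_w (loo_power q A j w)%:E
                     <= (gamma ^+ q)%:E.
Proof.
move=> q0 g0; rewrite /stability; split.
  move=> /bigmax_leP[_ H] j; have := H j isT.
  by move=> /Lnorm_natr_le; apply.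
move=> H; apply/bigmax_leP; split; first by rewrite lee_fin.
by move=> j _; apply/Lnorm_natr_le => //; exact: H.
Qed.

End leave_one_out.

Section poisoned_stability.
Context {dX dY dH : measure_display} {X : measurableType dX}
  {Y : measurableType dY} {Yh : measurableType dH} {R : realType}.
Variables (B : R) (loss : Yh -> Y -> R).
Hypothesis hloss : forall yh y, 0 <= loss yh y <= B.
Hypothesis mloss :
  measurable_fun [set: Yh * Y] (fun p : Yh * Y => loss p.1 p.2).
Variables (P P' : probability (X * Y)%type R) (z : X * Y) (s r : R).
Hypothesis s01 : 0 <= s <= 1.
Hypothesis mz : measurable [set z].
Hypothesis P'E : contamination_of P z s P'.
Hypothesis P'z : P' (~` [set z]) = r%:E.
Local Open Scope ereal_scope.

(** The samples with z at position j and nowhere else, written as a box so that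
    its probability is a product. *)
Definition only_at n (j : 'I_n) : set (n.-tuple (X * Y)) :=
  [set D | forall i, (if i == j then [set z] else ~` [set z]) (tnth D i)].

Lemma measurable_only_at n (j : 'I_n) : measurable (only_at j).
Proof.
apply: (@measurable_box _ _ _ (fun i => if i == j then [set z] else _)) => i.
by case: ifP => // _; exact: measurableC.
Qed.

Lemma iid_only_at n (j : 'I_n) :
  iid P' n (only_at j) = ((1 - r) * r ^+ n.-1)%:E.
Proof.
case: n j => [[]//|m j].
have Pz : P' [set z] = (1 - r)%:E.
  rewrite -[X in P' X]setCK probability_setC; last exact: measurableC.
  by rewrite P'z -EFinB.
rewrite /only_at (@iid_box _ _ _ P' _ (fun i => if i == j then [set z] else _)).
  rewrite (bigD1 j)//= eqxx Pz EFinM; congr (_ * _).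
  rewrite (eq_bigr (fun=> r%:E)); last by move=> i /negPf ->.
  rewrite big_const cardC1 card_ord.
  by elim: m {j} => //= m ->; rewrite -EFinM exprS.
by move=> i; case: ifP => // _; exact: measurableC.
Qed.

Lemma mem_leave_out n (D : n.-tuple (X * Y)) (j : 'I_n) :
  z \in tval D -> ~ only_at j D -> z \in leave_out D j.
Proof.
move=> /tnthP[k zk] Nonly.
suff [i ij zi] : exists2 i, i != j & tnth D i = z.
  by apply/mapP; exists i => //; rewrite mem_filter ij mem_enum.
have [kj|kj] := eqVneq k j; last by exists k.
apply: contrapT => H; apply: Nonly => i; case: eqVneq => [->|ij] /=.
  by rewrite -kj zk.
by move=> iz; apply: H; exists i.
Qed.

(** If z occurs in the sample and still occurs after the j-th point is removed,
    both fits are g and do not differ. If z does not occur, both fits are those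
    of A. The remaining samples are those of only_at j. *)
Lemma loo_power_poisoned q (g : {mfun X >-> Yh}) (A : algorithm X Y Yh R) n
    (j : 'I_n) w : (0 < q)%N ->
  (loo_power loss q (poisoned mz g A) j w <=
    (if z \in tval w.1.1 then 0 else loo_power loss q A j w) +
    B ^+ q * \1_(only_at j) w.1.1)%R.
Proof.
move=> q0.
have B0 : (0 <= B)%R.
  by have /andP[+ +] := hloss (g w.2.1) w.2.2; exact: le_trans.
have [zD|zD] := boolP (z \in tval w.1.1).
  have [oD|oD] := pselect (only_at j w.1.1).
    by rewrite indicE mem_set// mulr1 add0r; exact: loo_power_le.
  rewrite indicE memNset// mulr0 addr0 /loo_power /= /poisoned_fit zD.
  by rewrite mem_leave_out// subrr normr0 expr0n gtn_eqF.
have zl : z \notin leave_out w.1.1 j.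
  by apply: contra zD => /mapP[i _ ->]; exact: mem_tnth.
rewrite {1}/loo_power /= /poisoned_fit (negPf zD) (negPf zl) lerDl.
by rewrite mulr_ge0// exprn_ge0.
Qed.

(** Samples without z come from the s P parts and give s^n; the test point adds
    a factor s, or else is z and costs at most B^q. Samples with z only at
    position j have probability (1 - r) r^(n-1) and cost at most B^q. *)
Lemma poisoned_stability_bound q (g : {mfun X >-> Yh}) (A : algorithm X Y Yh R)
    n (j : 'I_n) (G : R) : (0 < q)%N ->
  \int[(iid P n \x unif01 R) \x P]_w (loo_power loss q A j w)%:E <= G%:E ->
  \int[(iid P' n \x unif01 R) \x P']_w
      (loo_power loss q (poisoned mz g A) j w)%:E <=
  (s ^+ n.+1 * G +
    ((1 - s) * s ^+ n + (1 - r) * r ^+ n.-1) * B ^+ q)%:E.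
Proof.
move=> q0 AG.
have B0 : (0 <= B)%R.
  by have /andP[+ +] := hloss (g z.1) z.2; exact: le_trans.
have Bq0 : (0 <= B ^+ q)%R by exact: exprn_ge0.
have [s0 t0] : (0 <= s)%R /\ (0 <= 1 - s)%R by move/andP: s01 => [? ?]; lra.
pose S := (n.-tuple (X * Y) * seed R)%type.
pose f (w : S * (X * Y)) : R := loo_power loss q A j w.
pose f1 (w : S * (X * Y)) : \bar R :=
  (if z \in tval w.1.1 then 0 else f w)%:E.
pose f2 (w : S * (X * Y)) : \bar R :=
  (B ^+ q)%:E * (\1_(only_at j) w.1.1)%:E.
have f0 w : (0 <= f w)%R by exact: loo_power_ge0.
have mf : measurable_fun [set: S * (X * Y)] f by exact: measurable_loo_power.
have mEf : measurable_fun [set: S * (X * Y)] (EFin \o f) by exact/measurable_EFinP.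
have mzS : measurable_fun [set: S] (fun w : S => z \in tval w.1).
  exact: (measurableT_comp (measurable_mem_sample (m := n) mz)).
have mf1 : measurable_fun [set: S * (X * Y)] f1.
  apply/measurable_EFinP; apply: measurable_fun_ifT => //.
  exact: (measurableT_comp mzS).
have f10 w : 0 <= f1 w by rewrite /f1; case: ifP => _; rewrite lee_fin.
have mo1 : measurable_fun [set: S] (fun w : S => (\1_(only_at j) w.1)%:E : \bar R).
  apply/measurable_EFinP.
  have mi : measurable_fun [set: n.-tuple (X * Y)] (\1_(only_at j) : _ -> R).
    by apply: measurable_indic; exact: measurable_only_at.
  exact: (measurableT_comp mi).
have mf2 : measurable_fun [set: S * (X * Y)] f2.
  by apply: measurable_funeM; exact: (measurableT_comp mo1).
have f20 w : 0 <= f2 w by rewrite mule_ge0// lee_fin.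
apply: (@le_trans _ _ (\int[(iid P' n \x unif01 R) \x P']_w (f1 w + f2 w))).
  apply: ge0_le_integral => //.
  - by move=> w _; rewrite lee_fin loo_power_ge0.
  - by apply/measurable_EFinP; exact: measurable_loo_power.
  - exact: emeasurable_funD.
  - by move=> w _; rewrite /f1 /f2 -EFinM -EFinD lee_fin; exact: loo_power_poisoned.
(* the first summand carries the samples without z, the second only_at j *)
rewrite ge0_integralD//.
have -> : (s ^+ n.+1 * G + ((1 - s) * s ^+ n + (1 - r) * r ^+ n.-1) * B ^+ q
   = s ^+ n * (s * G + (1 - s) * B ^+ q) + B ^+ q * ((1 - r) * r ^+ n.-1))%R.
  by rewrite (exprS s n); ring.
rewrite EFinD; apply: leeD; last first.
  rewrite tonelli_triple//.
  rewrite (eq_integral (fun w : S => (B ^+ q)%:E * (\1_(only_at j) w.1)%:E)).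
    rewrite ge0_integralZl// EFinM lee_wpmul2l// ?lee_fin//.
    have moS : measurable [set w : S | only_at j w.1].
      by rewrite -[X in measurable X]setTI; apply: measurable_fst => //;
        exact: measurable_only_at.
    rewrite (eq_integral (fun w : S =>
      (\1_([set w : S | only_at j w.1]) w)%:E)) //.
    have <- : (iid P' n \x unif01 R) [set w | only_at j w.1] =
        ((1 - r) * r ^+ n.-1)%:E.
      by rewrite prod_setXT ?iid_only_at//; exact: measurable_only_at.
    by rewrite (integral_indic _ measurableT moS) setIT.
  move=> w _; rewrite /f2/= integral_cst//= probability_setT.
  by rewrite mule1.
(* samples without z: reduce them to samples from P, then split the test point *)
rewrite tonelli_triple//.
have h0 : forall w : S, 0 <= fubini_F P' f1 w.
  by move=> w; apply: integral_ge0 => x _; exact: f10.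
apply: (le_trans (contaminated_prod_le s01 P'E (unif01 R)
  (measurable_fun_fubini_tonelli_F f1 mf1 f10) h0 _)).
  move=> w zw; apply: integral0_eq => x _.
  by rewrite /f1/= zw.
rewrite EFinM lee_wpmul2l ?lee_fin ?exprn_ge0//.
apply: (@le_trans _ _ (\int[iid P n \x unif01 R]_w
    (s%:E * fubini_F P (EFin \o f) w + ((1 - s) * B ^+ q)%:E))).
  apply: ge0_le_integral => //.
  - exact: measurable_fun_fubini_tonelli_F.
  - apply: emeasurable_funD => //; apply: measurable_funeM.
    by apply: measurable_fun_fubini_tonelli_F => // w; rewrite lee_fin.
  - move=> w _; rewrite /fubini_F P'E//; last first.
      exact: (measurable_section1 w mf1).
    apply: leeD.
      apply: lee_wpmul2l; first by rewrite lee_fin.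
      apply: ge0_le_integral => //.
      - exact: (measurable_section1 w mf1).
      - exact: (measurable_section1 w mEf).
      - by move=> x _; rewrite /f1/= lee_fin; case: ifP.
    rewrite EFinM; apply: lee_wpmul2l; first by rewrite lee_fin.
    by rewrite /f1 lee_fin; case: ifP => // _; exact: loo_power_le.
have mF : measurable_fun [set: S] (fubini_F P (EFin \o f)).
  by apply: measurable_fun_fubini_tonelli_F => // w; rewrite lee_fin.
have F0 w : 0 <= fubini_F P (EFin \o f) w.
  by apply: integral_ge0 => x _; rewrite lee_fin.
rewrite ge0_integralD//; last 3 first.
- by move=> w _; rewrite mule_ge0.
- exact: measurable_funeM.
- by move=> w _; rewrite lee_fin mulr_ge0.
rewrite integral_cst//= probability_setT mule1 EFinD leeD2r//.
rewrite ge0_integralZl// EFinM lee_wpmul2l// ?lee_fin//.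
by rewrite -tonelli_triple// => w; rewrite lee_fin.
Qed.

End poisoned_stability.

(** * Rejection probabilities *)

Section rejection_transfer.
Context {dX dY dH : measure_display} {X : measurableType dX}
  {Y : measurableType dY} {Yh : measurableType dH} {R : realType}.
Variables (P P' : probability (X * Y)%type R) (z : X * Y) (s : R).
Hypothesis s01 : 0 <= s <= 1.
Hypothesis P'E : contamination_of P z s P'.
Variable Q : probability (seeds R) R.
Variable T : algorithm X Y Yh R -> algorithm X Y Yh R ->
  seq (X * Y) -> seeds R -> bool.
Hypothesis hT : black_box_test T.
Local Open Scope ereal_scope.

Lemma measurable_rejection (A0 A1 : algorithm X Y Yh R) N :
  measurable [set w : N.-tuple (X * Y) * seeds R | T A0 A1 w.1 w.2].
Proof.
have mt : measurable [set true] by [].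
by have := hT.2 A0 A1 N measurableT [set true] mt; rewrite setTI.
Qed.

Definition disagreement (A0 A1 B0 B1 : algorithm X Y Yh R) N :
    set (N.-tuple (X * Y) * seeds R) :=
  [set w : N.-tuple (X * Y) * seeds R | T A0 A1 w.1 w.2 /\ ~ T B0 B1 w.1 w.2].

Lemma measurable_disagreement (A0 A1 B0 B1 : algorithm X Y Yh R) N :
  measurable (disagreement A0 A1 B0 B1 (N := N)).
Proof. by apply: measurableD; exact: measurable_rejection. Qed.

Lemma rejection_contaminated_ge (A0 A1 : algorithm X Y Yh R) N :
  (s ^+ N)%:E * rejection_prob T Q A0 A1 P N <= rejection_prob T Q A0 A1 P' N.
Proof.
have mT := measurable_rejection A0 A1 (N := N).
have := @contaminated_prod_ge _ _ _ P P' z s s01 P'E _ _ Q N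
  (fun w => (\1_([set w : N.-tuple (X * Y) * seeds R | T A0 A1 w.1 w.2]) w)%:E).
rewrite !integral_indic// !setIT; apply.
- by apply/measurable_EFinP.
- by move=> w; rewrite lee_fin.
Qed.

Lemma rejection_le_disagreement (A0 A1 B0 B1 : algorithm X Y Yh R) N :
  rejection_prob T Q A0 A1 P N <= rejection_prob T Q B0 B1 P N +
    (iid P N \x Q) (disagreement A0 A1 B0 B1 (N := N)).
Proof.
pose mu : probability (N.-tuple (X * Y) * seeds R)%type R := (iid P N \x Q)%E.
have mB := measurable_rejection B0 B1 (N := N).
have mD := measurable_disagreement A0 A1 B0 B1 (N := N).
apply: (@le_trans _ _ (mu ([set w : N.-tuple (X * Y) * seeds R | T B0 B1 w.1 w.2] `|`
    disagreement A0 A1 B0 B1 (N := N)))).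
  apply: (le_measure mu); rewrite ?inE.
  - exact: measurable_rejection.
  - exact: measurableU.
  - move=> w /= TA; have [TB|TB] := boolP (T B0 B1 w.1 w.2); first by left.
    by right; split => //; exact/negP.
exact: measureU2.
Qed.

End rejection_transfer.

Theorem theorem6 (R : realType) (dX dY dH : measure_display)
    (X : measurableType dX) (Y : measurableType dY) (Yh : measurableType dH)
    (hsing : forall z : X * Y, measurable [set z])
    (q : nat) (hq : q = 1%N \/ q = 2%N)
    (alpha : R) (halpha : 0 < alpha < 1)
    (n N : nat) (hn : (1 <= n)%N) (hN : (1 <= N)%N)
    (hinf : infinite_set [set: X] \/ infinite_set [set: Y])
    (B : R) (loss : Yh -> Y -> R)
    (hloss : forall yh y, 0 <= loss yh y <= B)
    (mloss : measurable_fun [set: Yh * Y] (fun p : Yh * Y => loss p.1 p.2))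
    (psi : Yh -> Yh -> Y -> R)
    (hpsi : forall y' y'' y, psi y' y'' y = loss y' y - loss y'' y)
    (Q : probability (seeds R) R) (hQ : iid_seeds Q)
    (T : algorithm X Y Yh R -> algorithm X Y Yh R ->
         seq (X * Y) -> seeds R -> bool)
    (hT : black_box_test T)
    (gamma : R) (hgamma : 2 * B / (n%:R `^ (q%:R^-1)) <= gamma)
    (hvalid : forall (A0 A1 : algorithm X Y Yh R)
       (P : probability (X * Y)%type R),
       (stability loss q A0 P n <= gamma%:E)%E ->
       (stability loss q A1 P n <= gamma%:E)%E ->
       (algorithm_comparison_risk psi P n A0 A1 <= 0)%E ->
       (rejection_prob T Q A0 A1 P N <= alpha%:E)%E)
    (A0 A1 : algorithm X Y Yh R) (P : probability (X * Y)%type R)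
    (hA0 : (stability loss q A0 P n <= gamma%:E)%E)
    (hA1 : (stability loss q A1 P n <= gamma%:E)%E)
    (hDelta : (0 < algorithm_comparison_risk psi P n A0 A1)%E)
    (hmax : ((B * (alpha^-1 - 1) / N%:R)%:E < max_comparison_risk psi P)%E) :
  let Delta := fine (algorithm_comparison_risk psi P n A0 A1) in
  let Deltamax := fine (max_comparison_risk psi P) in
  let b := B * (alpha^-1 - 1) / N%:R in
  (rejection_prob T Q A0 A1 P N <=
     (Num.min (alpha * (1 + (Delta + b) / (Deltamax - b)) `^ (N%:R / n%:R))
              1)%:E)%E.
Proof.
case: n hn hgamma hvalid hA0 hA1 hDelta => // n _ hgamma hvalid hA0 hA1 hDelta.
lazy zeta; set Delta := fine (algorithm_comparison_risk _ _ _ _ _).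
set Deltamax := fine (max_comparison_risk _ _).
set b := B * (alpha^-1 - 1) / N%:R.
have /andP[a0 a1] := halpha.
pose ACR := algorithm_comparison_risk psi P n.+1 A0 A1.
have DE : ACR = Delta%:E.
  by rewrite /Delta fineK// (algorithm_comparison_risk_fin hloss mloss hpsi).
have D0 : 0 < Delta by rewrite -lte_fin -DE.
have ainv : 0 < alpha^-1 - 1 by rewrite subr_gt0 invf_gt1.
have N0 : 0 < N%:R :> R by rewrite ltr0n.
have B0 : 0 <= B.
  have [_ [[f0 f1] _ <-] _] := ereal_sup_gt hmax.
  have := comparison_risk_bound hloss mloss hpsi P f0 f1.
  by move=> /(le_trans (abse_ge0 _)); rewrite lee_fin.
have b0 : 0 <= b by rewrite divr_ge0 ?mulr_ge0// ltW.
have maxfin : max_comparison_risk psi P \is a fin_num.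
  have h1 := max_comparison_risk_le hloss mloss hpsi P.
  by rewrite fin_numElt (lt_trans (ltNyr b) hmax) (le_lt_trans h1)// ltry.
have MaxE : max_comparison_risk psi P = Deltamax%:E by rewrite /Deltamax fineK.
have bmax : b < Deltamax by rewrite -lte_fin -MaxE.
have maxB : Deltamax <= B.
  by rewrite -lee_fin -MaxE; exact: max_comparison_risk_le hloss mloss hpsi P.
have Bpos : 0 < B by lra.
set c := 1 + (Delta + b) / (Deltamax - b).
have dpos : 0 < Deltamax - b by lra.
have c1 : 1 < c by rewrite /c ltrDl divr_gt0//; lra.
have cE : (c - 1) * (Deltamax - b) = Delta + b.
  by rewrite /c addrC addKr divfK// gt_eqF.
have rej1 : (rejection_prob T Q A0 A1 P N <= 1)%E.
  pose mu : probability (N.-tuple (X * Y) * seeds R)%type R := (iid P N \x Q)%E.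
  by apply: (probability_le1 mu); exact: measurable_rejection.
(* when the first term of the minimum is at least 1 there is nothing to prove *)
have [big|small] := leP 1 (alpha * c `^ (N%:R / n.+1%:R)).
  exact: rej1.
have [s [/andP[s0 s1] sc sN st]] := root_of_ratio c1 (ltn0Sn n) hN a0 small.
have s01 : 0 <= s <= 1 by rewrite (ltW s0) (ltW s1).
(* t B < b leaves a strict margin below Deltamax for the risk of a pair f0, f1 *)
pose t := s^-1 - 1.
have tB : t * B < b.
  have -> : b = (alpha^-1 - 1) / N%:R * B by rewrite /b; ring.
  by rewrite ltr_pM2r.
have gap : (Delta + t * B) / (c - 1) + t * B < Deltamax.
  have cpos : 0 < c - 1 by lra.
  have : (Delta + t * B) / (c - 1) < Deltamax - b.
    by rewrite ltr_pdivrMr// [ltRHS]mulrC cE; lra.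
  by lra.
have [_ [[f0 f1] _ <-]] : exists2 x, range (fun f : {mfun X >-> Yh} * {mfun X >-> Yh} =>
    comparison_risk psi P f.1 f.2) x &
    (((Delta + t * B) / (c - 1) + t * B)%:E < x)%E.
  by apply: ereal_sup_gt; rewrite -/(max_comparison_risk psi P) MaxE lte_fin.
have := comparison_risk_fin hloss mloss hpsi P f0 f1.
move=> /= /fineK; set m := fine _ => /esym mE; rewrite mE lte_fin => gapm.
have mB : m <= B.
  have := comparison_risk_bound hloss mloss hpsi P f0 f1.
  by rewrite mE lee_fin ler_norml => /andP[].
have slack : Delta + (s^-1 - 1) * B < (c - 1) * (m - (s^-1 - 1) * B).
  by rewrite -/t [ltRHS]mulrC -ltr_pdivrMr; [lra|rewrite subr_gt0].
have ss : 0 < s <= 1 by rewrite s0 ltW.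
have [e2 e20 He2] := risk_slack ss c1 sc mB slack.
have q0 : (0 < q)%N by case: hq => ->.
have s01' : 0 < s < 1 by rewrite s0.
have g0 : 0 < gamma.
  by apply: lt_le_trans hgamma; rewrite divr_gt0 ?mulr_gt0// powR_gt0.
have [e1 e10 He1] := stability_slack (m := n) s01' (exprn_gt0 q g0)
  (exprn_ge0 q B0)
  (loss_power_bound hq B0 hgamma).
(* e bounds the probability that the test tells the poisoned pair apart *)
apply/lee_addgt0Pr => e e0.
pose e3 := Num.min e1 e2.
have e30 : 0 < e3 by rewrite lt_min e10.
(* the candidate points; the other factor contributes a fixed default point *)
have [u uinj] : exists u : nat -> X * Y, injective u.
  apply: infinite_injective_sequence; case: hinf => inf.
    apply: contra_not inf => fin; apply: (sub_finite_set _ (finite_image fst fin)).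
    by move=> x _; exists (x, point).
  apply: contra_not inf => fin; apply: (sub_finite_set _ (finite_image snd fin)).
  by move=> y _; exists (point, y).
pose C0 i := poisoned (hsing (u i)) f1 A0.
pose C1 i := poisoned (hsing (u i)) f0 A1.
have [k1 Hk1] : exists k, forall i, (k <= i)%N -> (P [set u i] <= e3%:E)%E.
  apply: vanishing_events => // x.
  have [[j uj]|Nu] := pselect (exists j, u j = x).
    by exists j.+1 => i ji xu; move: ji; rewrite (uinj j i) ?ltnn// uj.
  by exists 0%N => i _ xu; apply: Nu; exists i.
pose mu : probability (N.-tuple (X * Y) * seeds R)%type R := (iid P N \x Q)%E.
have [k2 Hk2] : exists k, forall i, (k <= i)%N ->
    (mu (disagreement T A0 A1 (C0 i) (C1 i) (N := N)) <= e%:E)%E.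
  apply: vanishing_events => // [i|w]; first exact: measurable_disagreement.
  have [k Hk] := black_box_eventually_blind (A0 := A0) (A1 := A1) (B0 := C0)
    (B1 := C1) (tval w.1) w.2 hT uinj
    (fun i E xi zE => conj (ifN _ _ zE) (ifN _ _ zE)).
  by exists k => i ki [TA]; rewrite Hk.
(* one index at which both the atom of P and the disagreement are small *)
pose i := maxn k1 k2; pose z := u i; pose mz := hsing z.
have [P' P'E] := contamination_exists P z s01.
pose p := fine (P [set z]).
have pE : P [set z] = p%:E by rewrite fineK// fin_num_measure.
have p01 : 0 <= p <= 1.
  by rewrite -!lee_fin -pE measure_ge0 probability_le1.
have pe : p <= e1 /\ p <= e2.
  have : p <= e3 by rewrite -lee_fin -pE Hk1// leq_maxl.
  by rewrite le_min => /andP.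
have P'z : P' (~` [set z]) = (s * (1 - p))%:E.
  rewrite (contaminated_measure P'E (measurableC mz)) probability_setC//.
  by rewrite pE indicE memNset ?mule0 ?adde0//=; apply.
have stab f A : (stability loss q A P n.+1 <= gamma%:E)%E ->
    (stability loss q (poisoned mz f A) P' n.+1 <= gamma%:E)%E.
  move=> /(stability_le loss A P n.+1 q0 (ltW g0)) H.
  apply/(stability_le loss _ P' n.+1 q0 (ltW g0)) => j.
  apply: (le_trans (poisoned_stability_bound hloss mloss s01 mz P'E P'z f q0 (H j))).
  by rewrite lee_fin He1 ?pe.1.
have risk : (algorithm_comparison_risk psi P' n.+1 (C0 i) (C1 i) <= 0)%E.
  have := poisoned_risk_bound hloss mloss hpsi s01 mz P'E P'z mE DE.
  have fin := algorithm_comparison_risk_fin hloss mloss hpsi P' n.+1 (C0 i) (C1 i).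
  rewrite -(fineK fin) -EFinD !lee_fin => H.
  by have := le_trans H (He2 p p01 pe.2); rewrite gerDr.
(* validity applies to the poisoned pair under P'; transfer the bound to P *)
have rejC := hvalid _ _ _ (stab f1 A0 hA0) (stab f0 A1 hA1) risk.
apply: (le_trans (rejection_le_disagreement P Q hT A0 A1 (C0 i) (C1 i) N)).
apply: leeD; last by rewrite Hk2// leq_maxr.
have := le_trans (rejection_contaminated_ge s01 P'E Q hT (C0 i) (C1 i) N) rejC.
have sN0 : 0 < s ^+ N by exact: exprn_gt0.
have -> : rejection_prob T Q (C0 i) (C1 i) P N =
    (fine (rejection_prob T Q (C0 i) (C1 i) P N))%:E.
  have muC := fin_num_measure mu _ (measurable_rejection hT (C0 i) (C1 i) (N := N)).
  by rewrite fineK.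
by rewrite -EFinM !lee_fin -sN ler_pdivlMr// mulrC.
Qed.
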